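(* Let $d\ge2$. For every $U\in \mathrm{U}(\mathcal{H}_{d})$ there exist $A,B\in \mathrm{SU}(\mathcal{H}_{d})$ and $C\in \mathrm{U}(\mathcal{H}_{d})$, with $B$ and $C$ diagonal in the computational basis, such that $$\mathrm{C}^{2}_{1,2}(U)=(C \otimes AB)\cdot\mathrm{C}^{2}_{1,2}(X_d)\cdot (I_d \otimes B^{\dagger}) \cdot \mathrm{C}^{2}_{1,2}(X_{d}^{\dagger}) \cdot (I_d \otimes A^{\dagger}).$$ Moreover, the gate $C$ can be omitted (i.e. such a decomposition exists with $C=I_d$) if and only if $U\in \mathrm{SU}(\mathcal{H}_{d})$.
   Context: $\mathcal{H}_{d}$ is a $d$-dimensional complex Hilbert space with orthonormal (computational) basis $|0\rangle,\dots,|d-1\rangle$; $\mathrm{U}(\mathcal{H}_d)$ is the group of unitary operators and $\mathrm{SU}(\mathcal{H}_d)$ those of determinant $1$; $I_d$ is the identity on $\mathcal{H}_d$; $\dagger$ is the conjugate transpose. $X_d=|0\rangle\langle d-1|+\sum_{a=0}^{d-2}|a+1\rangle\langle a|$. For $U\in\mathrm{U}(\mathcal{H}_d)$, $\mathrm{C}^{2}_{1,2}(U)\in\mathrm{U}(\mathcal{H}_d\otimes\mathcal{H}_d)$ is defined by $\mathrm{C}^{2}_{1,2}(U)|x_1x_2\rangle=|x_1\rangle\otimes U|x_2\rangle$ if $x_1=d-1$ and $\mathrm{C}^{2}_{1,2}(U)|x_1x_2\rangle=|x_1x_2\rangle$ otherwise. *)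

(* Defs.v *)
From HB Require Import structures.
From mathcomp Require Import all_boot all_order all_algebra.
From mathcomp Require Import reals complex mxtens.

Set Implicit Arguments.
Unset Strict Implicit.
Unset Printing Implicit Defensive.

Import GRing.Theory Num.Theory.
Local Open Scope ring_scope.
Local Open Scope sesquilinear_scope.

(* Operators on H_d are their d x d matrices in the computational basis, acting
   on column vectors; H_d (x) H_d has dimension d * d, with basis vectors
   |x1 x2> = ket x1 *t ket x2. *)

Section Gates.
Context {C : numClosedFieldType} {d : nat}.

(* |a>; meaningful only for a < d (it is 0 otherwise). *)
Definition ket (a : nat) : 'cV[C]_d := \col_(i < d) (i == a :> nat)%:R.

Definition dagger m n (M : 'M[C]_(m, n)) : 'M[C]_(n, m) := M ^t*.

Definition is_SU (U : 'M[C]_d) : Prop := U \is unitarymx /\ \det U = 1.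

Definition Xgate : 'M[C]_d :=
  ket 0 *m dagger (ket d.-1)
  + \sum_(0 <= a < d.-1) ket a.+1 *m dagger (ket a).

Definition ctrl_ket (U : 'M[C]_d) (x1 x2 : 'I_d) : 'cV[C]_(d * d) :=
  if x1 == d.-1 :> nat then ket x1 *t (U *m ket x2) else ket x1 *t ket x2.

(* The column with index mxtens_index (x1, x2) is the image of |x1 x2>; see
   ctrlE below. *)
Definition ctrl (U : 'M[C]_d) : 'M[C]_(d * d) :=
  \matrix_(k, l)
    let x := mxtens_unindex l in ctrl_ket U x.1 x.2 k 0.

Lemma ctrlE (U : 'M[C]_d) (x1 x2 : 'I_d) :
  ctrl U *m (ket x1 *t ket x2) = ctrl_ket U x1 x2.
Proof.
apply/matrixP=> k j; rewrite (ord1 j : j = 0) mxE.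
rewrite (bigD1 (mxtens_index (x1, x2))) //= big1 => [|l nl].
  by rewrite !mxE !mxtens_indexK /= !eqxx !mulr1 addr0.
rewrite [X in _ * X]mxE.
case: (mxtens_unindex l) (mxtens_unindexK l) => y1 y2 /= ly.
rewrite !mxE -natrM mulnb; case: andP => [[/eqP e1 /eqP e2]|_]; last by rewrite mulr0.
by case/eqP: nl; rewrite -ly (val_inj e1) (val_inj e2).
Qed.

End Gates.

(* Main.v *)
Require Import Defs.
From mathcomp Require Import all_boot all_order all_algebra.
From mathcomp Require Import perm.
From mathcomp Require Import reals complex mxtens.

Import GRing.Theory Num.Theory.
Local Open Scope ring_scope.
Local Open Scope sesquilinear_scope.

(** On the control value [d-1] the right-hand side acts as
    [c *: (A B X B^* X^* A^* )], and as the identity on the other values, so the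
    task is to write [U] in that form.  Conjugation by [X] cyclically shifts the
    entries of a diagonal matrix, hence for [B = diag b] the matrix [B X B^* X^*]
    is diagonal with entries [b_i / b_(i-1)] (indices mod [d]); by telescoping,
    these are exactly the unimodular diagonals of product 1.  The spectral
    theorem and a [d]-th root [c] of [det U] reduce to that case. *)

(** * Unitary matrices: phases, determinants and diagonalisation *)

Section UnitaryMatrices.
Context {C : numClosedFieldType} {d : nat}.
Implicit Types (U V : 'M[C]_d) (v b : 'rV[C]_d) (c s z : C).

Lemma norm1_conjK {z} : `|z| = 1 -> z * z^* = 1.
Proof. by move=> z1; rewrite -normCK z1 expr1n. Qed.

Lemma unimodular_root {z} : (0 < d)%N -> `|z| = 1 ->
  exists2 s, `|s| = 1 & s ^+ d = z.
Proof.
move=> d_gt0 z1; exists (d.-root z); last exact: rootCK.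
by rewrite norm_rootC z1 rootC1.
Qed.

Lemma unitary_det_norm {U} : U \is unitarymx -> `|\det U| = 1.
Proof.
move=> /unitarymxP/(congr1 determinant); rewrite det_mulmx det_map_mx det_tr det1.
by rewrite -normCK => /eqP; rewrite sqrp_eq1 // => /eqP.
Qed.

Lemma scale_unitary {c U} : `|c| = 1 -> U \is unitarymx -> c *: U \is unitarymx.
Proof.
move=> c1 /unitarymxP UU; apply/unitarymxP.
rewrite linearZ /= map_mxZ -scalemxAl -scalemxAr UU scalerA norm1_conjK //.
exact: scale1r.
Qed.

Lemma daggerZ c m n (M : 'M[C]_(m, n)) : dagger (c *: M) = c^* *: dagger M.
Proof. by rewrite /dagger linearZ /= map_mxZ. Qed.

Lemma dagger_diag v : dagger (diag_mx v) = diag_mx (map_mx Num.conj v).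
Proof. by rewrite /dagger tr_diag_mx map_diag_mx. Qed.

Lemma dagger_unitary {U} : U \is unitarymx -> dagger U *m U = 1%:M.
Proof. by move=> /unitarymxP UU; apply: mulmx1C. Qed.

Lemma diag_unitaryP v :
  reflect (forall i, `|v 0 i| = 1) (diag_mx v \is unitarymx).
Proof.
have vv i : (diag_mx v *m dagger (diag_mx v)) i i = `|v 0 i| ^+ 2.
  by rewrite dagger_diag mulmx_diag !mxE eqxx normCK.
apply: (iffP unitarymxP) => [v1 i|v1].
  by move: (vv i); rewrite v1 mxE eqxx => /esym/eqP; rewrite sqrp_eq1 // => /eqP.
rewrite -/(dagger _) dagger_diag mulmx_diag.
by apply/matrixP=> i j; rewrite !mxE norm1_conjK.
Qed.

(** Scaling by [s] multiplies the determinant by [s ^+ d], so a [d]-th root of the inverse of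
    [\det U] serves; it is a phase because [\det U] has modulus 1. *)
Lemma unitary_scale_SU {U} : (0 < d)%N -> U \is unitarymx ->
  exists2 s, `|s| = 1 & is_SU (s *: U).
Proof.
move=> d_gt0 Uu; have D1 := unitary_det_norm Uu.
have [|s s1 sE] := @unimodular_root (\det U)^-1 d_gt0.
  by rewrite normfV D1 invr1.
exists s => //; split; first exact: scale_unitary.
by rewrite detZ sE mulVf // -normr_eq0 D1 oner_eq0.
Qed.

Lemma unitary_spectral {U} : U \is unitarymx ->
  exists V v, [/\ V \is unitarymx, diag_mx v \is unitarymx
                & U = V *m diag_mx v *m dagger V].
Proof.
move=> Uu; have Pu := spectral_unitarymx U.
have /orthomx_spectralP UE : U \is normalmx.
  by apply/normalmxP; rewrite (unitarymxP Uu) -/(dagger U) dagger_unitary.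
set P := spectralmx U in Pu UE; set v := spectral_diag U in UE.
have {}UE : U = dagger P *m diag_mx v *m P by rewrite /dagger -(invmx_unitary Pu).
(* The spectral theorem reads [U = P^-1 D P], so the eigenvector matrix is the adjoint of [P]. The
   diagonal factor is unitary, being the product [P U P^*] of unitaries. *)
exists (dagger P), v; split; first by rewrite trmxC_unitary.
  have -> : diag_mx v = P *m U *m dagger P.
    rewrite UE !mulmxA (unitarymxP Pu) mul1mx -mulmxA.
    by rewrite (unitarymxP Pu) mulmx1.
  by rewrite !mul_unitarymx // trmxC_unitary.
by rewrite {2}/dagger trmxCK.
Qed.

End UnitaryMatrices.

(** * The shift gate and its commutators with diagonal matrices *)

Section ControlledGates.
Context {C : numClosedFieldType} {d : nat}.
Implicit Types (U V A B : 'M[C]_d) (v b : 'rV[C]_d) (c : C) (i j : 'I_d).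

(** Row [i] of [perm_mx s] has its 1 in column [s i]; since X sends [a] to [a + 1], its row [i] has
    the 1 in column [i - 1], whence the cyclic predecessor. *)
Lemma XgateE : Xgate = perm_mx (perm (@ord_pred_inj d)) :> 'M[C]_d.
Proof.
case: d => [|n]; first by apply/matrixP=> -[].
have ketE (a b : nat) (i j : 'I_n.+1) :
    (ket a *m dagger (ket b) : 'M[C]_n.+1) i j = ((i == a :> nat) && (j == b :> nat))%:R.
  by rewrite mxE big_ord1 !mxE conjC_nat -natrM mulnb.
apply/matrixP=> i j; rewrite /Xgate mxE ketE summxE /=.
rewrite big_mkord; under eq_bigr do rewrite ketE.
rewrite !mxE permE -[X in (X == j)%:R]/(ord_pred i) -val_eqE /=.
(* Row 0 comes from the wrap-around term alone, row [i.+1] from the summand [a = i] alone. *)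
case: i => -[|i] /= lt_i.
  rewrite big1 ?addr0 //.
  by rewrite modn_small // eq_sym.
rewrite modnDr modn_small ?(ltnW lt_i) // add0r.
rewrite (bigD1 (Ordinal (lt_i : (i < n)%N))) //= eqxx big1 ?addr0 1?eq_sym // => a.
by rewrite -val_eqE /= eqSS => /negPf; rewrite eq_sym => ->.
Qed.

Lemma dagger_Xgate :
  dagger Xgate = perm_mx (perm (@ord_pred_inj d))^-1 :> 'M[C]_d.
Proof. by rewrite XgateE /dagger tr_perm_mx map_perm_mx. Qed.

Lemma Xgate_unitary : (Xgate : 'M[C]_d) \is unitarymx.
Proof.
apply/unitarymxP; rewrite -/(dagger _) dagger_Xgate XgateE -perm_mxM.
by rewrite mulgV perm_mx1.
Qed.

Lemma Xgate_conj_diag v :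
  Xgate *m diag_mx v *m dagger Xgate = diag_mx (\row_i v 0 (ord_pred i)).
Proof.
rewrite dagger_Xgate XgateE -row_permE -col_permE.
by apply/matrixP=> i j; rewrite !mxE !permE (inj_eq (@ord_pred_inj d)).
Qed.

(** For unitary [B] this is the group commutator of [B] and X. *)
Definition shift_comm B : 'M[C]_d :=
  B *m Xgate *m dagger B *m dagger Xgate.

Lemma shift_comm_diag b :
  shift_comm (diag_mx b) = diag_mx (\row_i (b 0 i * (b 0 (ord_pred i))^*)).
Proof.
rewrite /shift_comm dagger_diag -!mulmxA !(mulmxA Xgate) Xgate_conj_diag.
by rewrite mulmx_diag; congr diag_mx; apply/rowP=> i; rewrite !mxE.
Qed.

(** This leaves the phase of [B] free, so that its determinant can be normalised to 1. *)
Lemma shift_commZ c B : `|c| = 1 -> shift_comm (c *: B) = shift_comm B.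
Proof.
move=> c1; rewrite /shift_comm daggerZ -!scalemxAl -scalemxAr -!scalemxAl.
by rewrite scalerA norm1_conjK ?scale1r.
Qed.

Lemma det_shift_comm B : B \is unitarymx -> \det (shift_comm B) = 1.
Proof.
move=> Bu; rewrite /shift_comm !det_mulmx.
rewrite -mulrA mulrACA -!det_mulmx.
by rewrite (unitarymxP Bu) (unitarymxP Xgate_unitary) mulmx1 det1.
Qed.

Lemma cyclic_quotients {v} : (forall i, `|v 0 i| = 1) -> \prod_i v 0 i = 1 ->
  exists2 b : 'rV[C]_d, forall i, `|b 0 i| = 1
           & forall i, v 0 i = b 0 i * (b 0 (ord_pred i))^*.
Proof.
case: d v => [|n] v v1 vP; first by exists v => -[].
(* The partial products of [v] telescope: conjugation inverts a number of modulus 1, so each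
   quotient leaves the last factor. *)
exists (\row_i \prod_(k < n.+1 | (k <= i)%N) v 0 k) => [i|i]; rewrite !mxE.
  by rewrite normr_prod big1.
(* At index 0 the predecessor is [d - 1], whose partial product is the full product, equal to 1 by
   [vP]. *)
case: i => -[|i] lt_i /=.
  rewrite [X in _ * X^*](_ : _ = 1).
    rewrite conjC1 mulr1 (bigD1 (Ordinal lt_i)) //= big1 ?mulr1 // => k /andP[].
    by rewrite leqn0 -val_eqE /= => ->.
  rewrite -[RHS]vP; apply: eq_bigl => k; by rewrite modn_small // -ltnS ltn_ord.
rewrite modnDr modn_small ?(ltnW lt_i) //.
rewrite (bigD1 (Ordinal lt_i)) //= [X in _ * X * _](_ : _ =
  \prod_(k < n.+1 | (k <= i)%N) v 0 k); last first.
  by apply: eq_bigl => k; rewrite -val_eqE /= andbC -ltn_neqAle ltnS.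
by rewrite -mulrA norm1_conjK ?mulr1 // normr_prod big1.
Qed.

(** The eigenvalues of [U] are phases with product [\det U = 1], hence cyclic quotients, that is, a
    commutator with X in an eigenbasis. *)
Lemma SU_shift_comm {U} : (0 < d)%N -> is_SU U ->
  exists A B, [/\ is_SU A, is_SU B /\ is_diag_mx B
                & U = A *m shift_comm B *m dagger A].
Proof.
move=> d_gt0 [Uu detU]; have [V [v [Vu vu UE]]] := unitary_spectral Uu.
have vP : \prod_i v 0 i = 1.
  rewrite -det_diag -detU UE !det_mulmx mulrAC -det_mulmx.
  by rewrite (unitarymxP Vu) det1 mul1r.
have [b /diag_unitaryP bu bE] := cyclic_quotients (elimT (diag_unitaryP _) vu) vP.
have [s s1 As] := unitary_scale_SU d_gt0 Vu.
have [t t1 Bt] := unitary_scale_SU d_gt0 bu.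
(* Both normalising phases disappear: [s] meets its conjugate in the conjugation by [A], and [t]
   cancels inside the commutator. *)
exists (s *: V), (t *: diag_mx b); split=> //.
  by split=> //; rewrite -linearZ /= diag_mx_is_diag.
rewrite shift_commZ // shift_comm_diag daggerZ -!scalemxAl -scalemxAr scalerA.
rewrite norm1_conjK // scale1r UE; congr (_ *m diag_mx _ *m _).
by apply/rowP=> i; rewrite mxE.
Qed.

(** * Controlled gates through the projector onto the active control value *)

Definition last_proj : 'M[C]_d := diag_mx (\row_i (i == d.-1 :> nat)%:R).

Lemma last_projK : last_proj *m last_proj = last_proj.
Proof.
rewrite /last_proj mulmx_diag; congr diag_mx; apply/rowP=> i.
by rewrite !mxE -natrM mulnb andbb.
Qed.

Lemma last_projNK : (1%:M - last_proj) *m last_proj = 0.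
Proof. by rewrite mulmxBl mul1mx last_projK subrr. Qed.

Lemma last_projKN : last_proj *m (1%:M - last_proj) = 0.
Proof. by rewrite mulmxBr mulmx1 last_projK subrr. Qed.

Lemma last_projNN :
  (1%:M - last_proj) *m (1%:M - last_proj) = 1%:M - last_proj.
Proof. by rewrite mulmxBr mulmx1 last_projNK subr0. Qed.

Lemma ctrl_tens U :
  ctrl U = (1%:M - last_proj) *t (1%:M : 'M_d) + last_proj *t U.
Proof.
have ketE i j : (ket i : 'cV[C]_d) j 0 = (j == i)%:R by rewrite mxE.
have tensE (u w : 'cV[C]_d) i j : (u *t w) (mxtens_index (i, j)) 0 = u i 0 * w j 0.
  by rewrite mxE mxtens_indexK !ord1.
apply/matrixP=> k l; rewrite [LHS]mxE /ctrl_ket.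
case: (mxtens_indexP k) => k1 k2; case: (mxtens_indexP l) => l1 l2.
rewrite mxtens_indexK [RHS]mxE !tensmxE /=.
have UE : (U *m ket l2) k2 0 = U k2 l2.
  rewrite mxE (bigD1 l2) //= ketE eqxx mulr1 big1 ?addr0 // => j nj.
  by rewrite ketE (negPf nj) mulr0.
have [<-|nkl] := eqVneq k1 l1; case: ifP => l1E; rewrite tensE !ketE ?UE.
- by rewrite !mxE l1E !eqxx subrr mul0r add0r.
- by rewrite !mxE l1E !eqxx subr0 mul0r addr0.
- by rewrite !mxE (negPf nkl) subrr !mul0r addr0.
- by rewrite !mxE (negPf nkl) subrr !mul0r addr0.
Qed.

Lemma ctrl_mul_target U V :
  ctrl U *m (1%:M *t V) = (1%:M - last_proj) *t V + last_proj *t (U *m V).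
Proof. by rewrite ctrl_tens mulmxDl !tensmx_mul !mulmx1 mul1mx. Qed.

Lemma ctrl_inj : (0 < d)%N -> injective (@ctrl C d).
Proof.
move=> d_gt0 U V; rewrite !ctrl_tens => /addrI UV.
have lt_d : (d.-1 < d)%N by rewrite prednK.
(* The block at control value [d - 1] contains the target gate; positivity of [d] makes this value
   exist. *)
set o := Ordinal lt_d; apply/matrixP=> i j.
move/matrixP/(_ (mxtens_index (o, i)) (mxtens_index (o, j))): UV.
by rewrite !tensmxE !mxE !eqxx !mul1r.
Qed.

(** Phase kickback: a scalar on the controlled gate is realised by a diagonal gate on the
    control. *)
Definition control_phase c : 'M[C]_d :=
  diag_mx (\row_i (if i == d.-1 :> nat then c else 1)).

Lemma control_phase1 : control_phase 1 = 1%:M.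
Proof.
rewrite -diag_const_mx; congr diag_mx.
by apply/rowP=> i; rewrite !mxE if_same.
Qed.

Lemma control_phase_unitary c : `|c| = 1 -> control_phase c \is unitarymx.
Proof.
by move=> c1; apply/diag_unitaryP=> i; rewrite mxE; case: ifP; rewrite ?normr1.
Qed.

Lemma control_phaseE c : control_phase c = (1%:M - last_proj) + c *: last_proj.
Proof.
apply/matrixP=> i j; rewrite !mxE.
have [_|_] := eqVneq i j; last by rewrite !mulr0n mulr0 subrr addr0.
by rewrite !mulr1n; case: ifP => _; rewrite ?subrr ?subr0 ?mulr1 ?mulr0 ?add0r ?addr0.
Qed.

Lemma tensmx_scaleAC c m n p q (M : 'M[C]_(m, n)) (N : 'M[C]_(p, q)) :
  (c *: M) *t N = M *t (c *: N).
Proof. by apply/matrixP=> k l; rewrite !mxE mulrCA mulrA. Qed.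

Lemma control_phase_proj c : control_phase c *m last_proj = c *: last_proj.
Proof.
by rewrite control_phaseE mulmxDl -scalemxAl last_projNK last_projK add0r.
Qed.

Lemma control_phase_projN c :
  control_phase c *m (1%:M - last_proj) = 1%:M - last_proj.
Proof.
rewrite control_phaseE mulmxDl -scalemxAl last_projNN last_projKN scaler0.
exact: addr0.
Qed.

(** Complementary projectors kill the cross terms. Off the active value the target sees
    [A B B^* A^* = 1]; on it, the phase [c] moves across the tensor product to the target. *)
Lemma circuit_ctrl c A B : A \is unitarymx -> B \is unitarymx ->
  (control_phase c *t (A *m B)) *m ctrl Xgate *m (1%:M *t dagger B)
    *m ctrl (dagger Xgate) *m (1%:M *t dagger A)
  = ctrl (c *: (A *m shift_comm B *m dagger A)).
Proof.
move=> Au Bu; rewrite -!mulmxA (mulmxA (ctrl Xgate)) !ctrl_mul_target.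
rewrite mulmxDl !mulmxDr !tensmx_mul last_projNN last_projNK last_projKN.
rewrite last_projK !mulmx0 !tens0mx addr0 add0r !mulmxA ctrl_tens.
rewrite control_phase_projN control_phase_proj; congr (_ + _).
  congr (_ *t _).
  by rewrite -(mulmxA A) (unitarymxP Bu) mulmx1 (unitarymxP Au).
by rewrite tensmx_scaleAC.
Qed.

Lemma ctrl_decomposition U : (0 < d)%N -> U \is unitarymx ->
  exists A B P : 'M[C]_d,
     [/\ is_SU A, is_SU B /\ is_diag_mx B, P \is unitarymx /\ is_diag_mx P
       & ctrl U = (P *t (A *m B)) *m ctrl Xgate *m (1%:M *t dagger B)
                    *m ctrl (dagger Xgate) *m (1%:M *t dagger A)].
Proof.
move=> d_gt0 Uu; have [s s1 sU] := unitary_scale_SU d_gt0 Uu.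
have [A [B [[Au Ad] [[Bu Bd] Bdiag] sUE]]] := SU_shift_comm d_gt0 sU.
(* The commutator form was obtained for [s *: U]; the control phase [s^*] undoes that scaling. *)
exists A, B, (control_phase s^*); split=> //.
  by rewrite control_phase_unitary ?norm_conjC // diag_mx_is_diag.
by rewrite circuit_ctrl // -sUE scalerA mulrC norm1_conjK // scale1r.
Qed.

Lemma ctrl_decomposition_SU U : (0 < d)%N -> U \is unitarymx ->
  (exists A B : 'M[C]_d,
     [/\ is_SU A, is_SU B /\ is_diag_mx B
       & ctrl U = (1%:M *t (A *m B)) *m ctrl Xgate *m (1%:M *t dagger B)
                    *m ctrl (dagger Xgate) *m (1%:M *t dagger A)])
  <-> is_SU U.
Proof.
move=> d_gt0 Uu; split.
(* With trivial phase, injectivity of [ctrl] makes [U] a conjugate of a commutator, so its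
   determinant is 1. *)
- move=> [A [B [[Au _] [[Bu _] _]]]]; rewrite -{1}control_phase1.
  rewrite circuit_ctrl // scale1r => /(ctrl_inj d_gt0) UE.
  split=> //; rewrite UE 2!det_mulmx mulrAC -det_mulmx (unitarymxP Au).
  by rewrite det_shift_comm // det1 mulr1.
- move=> /(SU_shift_comm d_gt0)[A [B [[Au Ad] [[Bu Bd] Bdiag] UE]]].
  exists A, B; split=> //.
  by rewrite -{1}control_phase1 circuit_ctrl // scale1r -UE.
Qed.

End ControlledGates.

Theorem mainTheorem3 (R : realType) (d : nat) (hd : (2 <= d)%N)
    (U : 'M[R[i]]_d) (hU : U \is unitarymx) :
  (exists A B C : 'M[R[i]]_d,
     [/\ is_SU A, is_SU B /\ is_diag_mx B, C \is unitarymx /\ is_diag_mx C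
       & ctrl U = (C *t (A *m B)) *m ctrl Xgate *m (1%:M *t dagger B)
                    *m ctrl (dagger Xgate) *m (1%:M *t dagger A)])
  /\
  ((exists A B : 'M[R[i]]_d,
     [/\ is_SU A, is_SU B /\ is_diag_mx B
       & ctrl U = (1%:M *t (A *m B)) *m ctrl Xgate *m (1%:M *t dagger B)
                    *m ctrl (dagger Xgate) *m (1%:M *t dagger A)])
   <-> is_SU U).
Proof.
have d_gt0 : (0 < d)%N by apply: leq_trans hd.
by split; [exact: ctrl_decomposition | exact: ctrl_decomposition_SU].
Qed.
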